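(* There is a sequence of real numbers $(\varepsilon_n)_{n\ge1}$ with $\varepsilon_n\to0$ as $n\to\infty$ such that the following holds for every positive integer $n$. Let $R_K>2$ be a real number and let $K\subset\mathbb{E}^n$ be a $1$-separated set of diameter at most $R_K-1$. If $|K|>(6.79+\varepsilon_n)^n\log R_K$, then $\mathbb{E}^n\not\to(\ell_2,K)$.
   Context: $\mathbb{E}^n$ denotes $\mathbb{R}^n$ with the Euclidean norm. A set is $1$-separated if all pairs of distinct points of it are at distance at least $1$. $\ell_2$ is a pair of points at distance $1$. We write $\mathbb{E}^n\not\to(S_1,S_2)$ if there is a two-coloring of $\mathbb{E}^n$ (colors red and blue) with no all-red congruent copy of $S_1$ and no all-blue congruent copy of $S_2$. Logarithms are natural. *)

(* Defs.v *)
From mathcomp Require Import all_boot all_order all_algebra.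
From mathcomp Require Import all_classical all_reals all_analysis.
Set Implicit Arguments.
Unset Strict Implicit.
Unset Printing Implicit Defensive.
Import Order.TTheory GRing.Theory Num.Theory.
Import numFieldNormedType.Exports.
Local Open Scope classical_set_scope.
Local Open Scope ring_scope.

(* E^n is 'rV[R]_n with the distance below; the canonical norm of 'rV[R]_n
   in MathComp-Analysis is the sup norm, hence is not used. *)
Definition edist (R : realType) (n : nat) (x y : 'rV[R]_n) : R :=
  Num.sqrt (\sum_(i < n) (x 0 i - y 0 i) ^+ 2).

(* The diameter of the empty set is -oo. *)
Definition diameter (R : realType) (n : nat) (S : set 'rV[R]_n) : \bar R :=
  ereal_sup [set (edist x y)%:E | x in S & y in S].

Definition one_separated (R : realType) (n : nat) (S : set 'rV[R]_n) : Prop :=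
  forall x y, S x -> S y -> x <> y -> 1 <= edist x y.

(* Distance-preserving self-maps of E^n are automatically surjective. *)
Definition isometry (R : realType) (n : nat) (f : 'rV[R]_n -> 'rV[R]_n) : Prop :=
  forall x y, edist (f x) (f y) = edist x y.

Definition congruent (R : realType) (n : nat) (S T : set 'rV[R]_n) : Prop :=
  exists2 f, isometry f & T = f @` S.

(* In a fixed E^n all such pairs are congruent. *)
Definition is_ell2 (R : realType) (n : nat) (L : set 'rV[R]_n) : Prop :=
  exists p q, edist p q = 1 /\ L = [set p; q].

Inductive color : Type := red | blue.

Definition monochromatic (R : realType) (n : nat) (chi : 'rV[R]_n -> color)
    (c : color) (S : set 'rV[R]_n) : Prop :=
  forall x, S x -> chi x = c.

Definition not_arrow (R : realType) (n : nat) (S1 S2 : set 'rV[R]_n) : Prop :=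
  exists chi : 'rV[R]_n -> color,
    (~ exists2 T, congruent S1 T & monochromatic chi red T) /\
    (~ exists2 T, congruent S2 T & monochromatic chi blue T).

(* Main.v *)
Require Import Defs.
From mathcomp Require Import all_boot all_order all_algebra.
From mathcomp Require Import boolp ring lra zify.
Set Implicit Arguments.
Unset Strict Implicit.
Unset Printing Implicit Defensive.
Import Order.TTheory GRing.Theory Num.Theory.
Local Open Scope ring_scope.

(** Color red the open balls of radius 1/2 around a set of centers whose
    pairwise distances are at least 2: two red points are then either in one
    ball, at distance less than 1, or in different balls, at distance more than
    1.  The task is to choose the centers so that every congruent copy of K
    meets a red ball.

    The centers are taken on a fine periodic grid, that is, in the finite group
    (Z/M)^n, whose period exceeds the diameter of K by enough for a copy of K
    never to wrap around.  An admissible set of centers is an independent set X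
    of the graph joining grid points at distance less than 2.  Let Z(A) be the
    sum of lam^|X| over the independent sets X contained in A (the hard-core
    partition function).  If all closed neighborhoods have at most d elements,
    deleting one vertex from A multiplies Z(A) by at most 1 - p with
    p = lam/(1+lam)^d, whatever A is ([hardcore_avoid]).  Hence a random X of
    the hard-core model misses a prescribed set D of vertices with probability
    at most (1-p)^|D|, a bound as good as independence would give.  With
    lam = 1/(2d) one has p >= 1/(4d).

    For a copy f(K), let D be the set of grid points well within 1/2 of some
    point of f(K).  As K is 1-separated, these are |K| disjoint balls, so |D| is
    |K| times the number b of grid points of a ball of radius slightly more than
    1/3.  Rescaling by 6, with the remainders modulo 6 as extra data, maps the
    ball of radius 2 into this one, so d <= 6^n b ([card_ball_residues]): no
    volume is computed.  So f(K) is missed with probability at most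
    exp(-|K|/(4*6^n)).

    A net of isometries reduces the copies of K to finitely many, their number
    being at most exp(290 n^4 log R_K): an isometry is affine, hence is known up
    to a small error on K once the image of one point is known up to a grid step
    and period and its matrix is known up to about 1/(12 n^2 R_K)
    ([net_index_near], [net_card_bound]).  The union bound therefore succeeds as
    soon as |K| > 1160 n^4 6^n log R_K ([avoiding_coloring]), and since
    6 < 6.79 the factor 1160 n^4 6^n is at most 6.79^n for all large n; for the
    finitely many other n, eps_n is taken to be this factor. *)

(** * The hard-core model *)

(** Neighborhoods are closed, so [nbh x] contains [x]. *)
Definition independent (V : finType) (nbh : V -> {set V}) (X : {set V}) : bool :=
  [forall x in X, forall y in X, (y \in nbh x) ==> (y == x)].

Definition hardcore_sum (R : realFieldType) (V : finType) (nbh : V -> {set V})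
    (lam : R) (A : {set V}) : R :=
  \sum_(X : {set V} | (X \subset A) && independent nbh X) lam ^+ #|X|.

Section HardCore.
Variables (R : realFieldType) (V : finType) (nbh : V -> {set V}) (lam : R).
Hypotheses (nbh_refl : forall v, v \in nbh v)
  (nbh_sym : forall u v, (u \in nbh v) = (v \in nbh u)) (lam_ge0 : 0 <= lam).
Local Notation Z := (hardcore_sum nbh lam).
Local Notation indep := (independent nbh).

Lemma independentP (X : {set V}) :
  reflect (forall x y, x \in X -> y \in X -> y \in nbh x -> y = x) (indep X).
Proof.
apply: (iffP forall_inP) => [h x y xX yX yx|h x xX].
  by move/forall_inP: (h x xX) => /(_ y yX)/implyP/(_ yx)/eqP.
by apply/forall_inP => y yX; apply/implyP => yx; apply/eqP; exact: h.
Qed.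

Lemma hardcore_sum_mono (A B : {set V}) : A \subset B -> Z A <= Z B.
Proof.
move=> AB; rewrite /hardcore_sum [leRHS](bigID (fun X : {set V} => X \subset A)) /=.
rewrite [X in _ <= X + _](eq_bigl (fun X : {set V} => (X \subset A) && indep X)).
  by rewrite lerDl sumr_ge0 // => X _; rewrite exprn_ge0.
move=> X; case XA: (X \subset A); last by rewrite !andbF.
by rewrite (subset_trans XA AB) andbT.
Qed.

Lemma hardcore_sum_gt0 (A : {set V}) : 0 < Z A.
Proof.
rewrite /hardcore_sum (bigD1 set0) /=.
  rewrite cards0 expr0 ltr_pwDl ?ltr01// sumr_ge0 // => X _.
  by rewrite exprn_ge0.
by rewrite sub0set; apply/independentP => x y; rewrite inE.
Qed.

(** The independent sets containing [v] correspond, by deleting [v], to the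
    independent sets that avoid the neighborhood of [v]. *)
Lemma hardcore_sum_rec (A : {set V}) (v : V) : v \in A ->
  Z A = Z (A :\ v) + lam * Z (A :\: nbh v).
Proof.
move=> vA; rewrite /hardcore_sum (bigID (fun X : {set V} => v \notin X)) /=.
congr (_ + _).
  apply: eq_bigl => X; rewrite subsetD1; by rewrite andbAC.
rewrite (reindex_onto (fun Y => v |: Y) (fun X => X :\ v)) /=; last first.
  by move=> X /andP[_]; rewrite negbK => vX; rewrite setD1K.
rewrite mulr_sumr; apply: eq_big => [Y|Y]; last first.
  move=> /andP[_ /eqP h].
  have vY : v \notin Y by rewrite -h !inE eqxx.
  by rewrite cardsU1 vY exprS.
apply/idP/idP.
  move=> /andP[/andP[/andP[sA /independentP ind] _] /eqP h].
  have vY : v \notin Y by rewrite -h !inE eqxx.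
  rewrite subsetD; apply/andP; split.
    apply/andP; split; first by apply: subset_trans sA; exact: subsetUr.
    rewrite disjoint_subset; apply/subsetP => y yY; rewrite inE.
    apply/negP => yv; move: vY; rewrite -(ind v y) ?yY// ?setU11//.
    by rewrite setU1r.
  by apply/independentP => x y xY yY; apply: ind; rewrite setU1r.
move=> /andP[]; rewrite subsetD => /andP[sA dis] /independentP ind.
have vY : v \notin Y.
  apply/negP => vY; move: dis; rewrite disjoint_subset => /subsetP/(_ v vY).
  by rewrite inE nbh_refl.
have nY y : y \in Y -> y \notin nbh v.
  by move: dis; rewrite disjoint_subset => /subsetP h /h; rewrite inE.
rewrite setU11 /= (setU1K vY) eqxx !andbT; apply/andP; split.
  by rewrite subUset sub1set vA.
apply/independentP => x y /setU1P[->|xY] /setU1P[->|yY] //.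
- by move=> h; move: (nY y yY); rewrite h.
- by rewrite nbh_sym => h; move: (nY x xY); rewrite h.
- exact: ind.
Qed.

(** Deleting a vertex divides the sum by at most [1 + lam], because the sets
    containing it inject into those that do not. *)
Lemma hardcore_sum_setD (A B : {set V}) :
  Z A <= (1 + lam) ^+ #|B| * Z (A :\: B).
Proof.
have l1 : 0 <= 1 + lam by rewrite addr_ge0.
elim: {B}#|B| {-2}B (erefl #|B|) => [|k ih] B.
  by move/eqP; rewrite cards_eq0 => /eqP->; rewrite cards0 expr0 mul1r setD0.
move=> Bk; have /card_gt0P[v vB] : (0 < #|B|)%N by rewrite Bk.
have Bv : #|B :\ v| = k by move: (cardsD1 v B); rewrite vB Bk => -[].
apply: (le_trans (ih _ Bv)); rewrite Bv Bk exprSr -mulrA ler_wpM2l ?exprn_ge0 //.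
have -> : A :\: B = (A :\: (B :\ v)) :\ v.
  apply/setP => x; rewrite !inE; case: eqP => [->|_] //=; by rewrite vB.
have [vA|vA] := boolP (v \in A :\: (B :\ v)).
  rewrite (hardcore_sum_rec vA) mulrDl mul1r lerD2l ler_wpM2l //.
  by apply: hardcore_sum_mono; apply: setDS; rewrite sub1set.
have -> : (A :\: (B :\ v)) :\ v = A :\: (B :\ v).
  by apply/setP => x; rewrite in_setD1; case: eqP vA => [->|_] //= /negbTE ->.
by rewrite ler_peMl ?lerDl ?(ltW (hardcore_sum_gt0 _)).
Qed.

(** In any induced subgraph, the sets containing a given vertex [v] have total
    weight [lam] times the sum over the graph without the neighborhood of [v],
    hence carry a proportion at least [lam / (1 + lam) ^+ d] of the whole.
    Deleting the vertices of [D] one at a time, this loss is incurred at each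
    step. *)
Lemma hardcore_avoid (d : nat) (D : {set V}) :
  (forall v, #|nbh v| <= d)%N -> lam / (1 + lam) ^+ d <= 1 ->
  Z (~: D) <= (1 - lam / (1 + lam) ^+ d) ^+ #|D| * Z [set: V].
Proof.
move=> nbh_card; set p := lam / _ => p1.
have l1 : 1 <= 1 + lam by rewrite lerDl.
elim: {D}#|D| {-2}D (erefl #|D|) => [|k ih] D.
  by move/eqP; rewrite cards_eq0 => /eqP->; rewrite cards0 expr0 mul1r setC0.
move=> Dk; have /card_gt0P[v vD] : (0 < #|D|)%N by rewrite Dk.
have Dv : #|D :\ v| = k by move: (cardsD1 v D); rewrite vD Dk => -[].
have := ih _ Dv; rewrite Dk Dv exprS -mulrA => {}ih.
apply: (le_trans _ (ler_wpM2l _ ih)); last by rewrite subr_ge0.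
have vA : v \in ~: (D :\ v) by rewrite !inE eqxx.
have -> : ~: D = ~: (D :\ v) :\ v.
  by apply/setP => x; rewrite !inE; case: (x =P v) => [->|] //=; rewrite vD.
rewrite mulrBl mul1r lerBrDr [leRHS](hardcore_sum_rec vA) lerD2l.
rewrite -mulrA ler_wpM2l // mulrC ler_pdivrMr; last first.
  by rewrite exprn_gt0 // (lt_le_trans ltr01).
rewrite mulrC; apply: (le_trans (hardcore_sum_setD _ (nbh v))).
by rewrite ler_wpM2r ?(ltW (hardcore_sum_gt0 _)) // ler_weXn2l.
Qed.

(** The union bound for a random independent set of the hard-core model. *)
Lemma independent_hitting (I : finType) (P : pred I) (D : I -> {set V})
    (d s : nat) :
  (forall v, #|nbh v| <= d)%N -> lam / (1 + lam) ^+ d <= 1 ->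
  (forall i, P i -> s <= #|D i|)%N ->
  #|I|%:R * (1 - lam / (1 + lam) ^+ d) ^+ s < 1 ->
  exists X, indep X /\ forall i, P i -> exists2 v, v \in X & v \in D i.
Proof.
move=> nbh_card p1 Ds small; set p := lam / _ in p1 small.
have p0 : 0 <= p by rewrite divr_ge0 ?exprn_ge0 // addr_ge0.
have q0 : 0 <= 1 - p by rewrite subr_ge0.
have q1 : 1 - p <= 1 by rewrite gerBl.
have : \sum_(i | P i) Z (~: D i) < Z [set: V].
  apply: (@le_lt_trans _ _ (\sum_(i : I) (1 - p) ^+ s * Z [set: V])).
    rewrite [leRHS](bigID P) /= ler_wpDr //.
      by apply: sumr_ge0 => i _; rewrite mulr_ge0 ?exprn_ge0 ?(ltW (hardcore_sum_gt0 _)).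
    apply: ler_sum => i Pi; apply: (le_trans (hardcore_avoid _ nbh_card p1)).
    rewrite ler_wpM2r ?(ltW (hardcore_sum_gt0 _)) //.
    exact: ler_wiXn2l (Ds i Pi).
  rewrite sumr_const -[in ltLHS]mulr_natl mulrA.
  by rewrite -[ltRHS]mul1r ltr_pM2r // hardcore_sum_gt0.
move=> lt_sum; have [[X /andP[Xi /forall_inP XD]]|none] := pselect (exists X : {set V},
    indep X && [forall (i | P i), ~~ [disjoint X & D i]]).
  exists X; split=> // i /XD; rewrite -setI_eq0 => /set0Pn[v].
  by rewrite inE => /andP[]; exists v.
move: lt_sum; rewrite ltNge => /negP[].
rewrite /hardcore_sum [leRHS](exchange_big_dep (fun X => indep X)) /=; last first.
  by move=> i X _ /andP[].
rewrite [leLHS](eq_bigl indep) /=; last by move=> X; rewrite subsetT.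
apply: ler_sum => X Xi.
have /existsP[i /andP[Pi XDi]] : [exists i, P i && [disjoint X & D i]].
  apply: contra_notT none; rewrite negb_exists => /forallP h; exists X.
  rewrite Xi; apply/forall_inP => i Pi; move: (h i); by rewrite Pi.
rewrite (bigD1 i) /=; last by rewrite Pi Xi andbT -disjoints_subset.
by rewrite lerDl sumr_ge0 // => j _; rewrite exprn_ge0.
Qed.

End HardCore.

From mathcomp Require Import all_classical all_reals all_analysis.
Import numFieldNormedType.Exports.
Local Open Scope classical_set_scope.
Local Open Scope ring_scope.

(** * Euclidean norm and isometries *)

Section Euclid.
Variables (R : realType) (n : nat).
Implicit Types (u v w : 'rV[R]_n).

Definition dot u v : R := \sum_i u 0 i * v 0 i.
Definition enorm u : R := Num.sqrt (dot u u).

Lemma edist_enorm u v : Defs.edist u v = enorm (u - v).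
Proof.
rewrite /Defs.edist /enorm /dot; congr Num.sqrt; apply: eq_bigr => i _.
by rewrite !mxE expr2.
Qed.

Lemma dotC u v : dot u v = dot v u.
Proof. by apply: eq_bigr => i _; rewrite mulrC. Qed.

Lemma dotDl u v w : dot (u + v) w = dot u w + dot v w.
Proof. by rewrite -big_split; apply: eq_bigr => i _; rewrite mxE mulrDl. Qed.

Lemma dotZl a u v : dot (a *: u) v = a * dot u v.
Proof. by rewrite mulr_sumr; apply: eq_bigr => i _; rewrite mxE mulrA. Qed.

Lemma dotDr u v w : dot w (u + v) = dot w u + dot w v.
Proof. by rewrite dotC dotDl !(dotC w). Qed.

Lemma dotZr a u v : dot u (a *: v) = a * dot u v.
Proof. by rewrite dotC dotZl (dotC v). Qed.

Lemma dot_ge0 u : 0 <= dot u u.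
Proof. by apply: sumr_ge0 => i _; rewrite -expr2 sqr_ge0. Qed.

Lemma enorm_ge0 u : 0 <= enorm u. Proof. exact: sqrtr_ge0. Qed.

Lemma enorm_sqr u : enorm u ^+ 2 = dot u u.
Proof. by rewrite sqr_sqrtr // dot_ge0. Qed.

Lemma dot_eq0 u : dot u u = 0 -> u = 0.
Proof.
move/eqP; rewrite psumr_eq0; last by move=> i _; rewrite -expr2 sqr_ge0.
move/allP => h; apply/rowP => i; rewrite mxE; apply/eqP.
by move: (h i (mem_index_enum _)); rewrite /= -expr2 sqrf_eq0.
Qed.

Lemma cauchy_schwarz u v : dot u v <= enorm u * enorm v.
Proof.
have [v0|v0] := eqVneq (dot v v) 0.
  have -> : dot u v = 0.
    by rewrite (dot_eq0 v0) /dot big1 // => i _; rewrite mxE mulr0.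
  by rewrite mulr_ge0 ?enorm_ge0.
have vpos : 0 < dot v v by rewrite lt_neqAle eq_sym v0 dot_ge0.
apply: le_trans (ler_norm _) _; rewrite -ler_sqr ?nnegrE ?mulr_ge0 ?enorm_ge0 //.
rewrite real_normK ?num_real // exprMn !enorm_sqr.
have := dot_ge0 (dot v v *: u + (- dot u v) *: v).
rewrite !(dotDl, dotDr, dotZl, dotZr) (dotC v u) => h.
(* The norm of <v,v>u - <u,v>v is <v,v> times the defect of the inequality. *)
rewrite -subr_ge0 -(pmulr_rge0 _ vpos); apply: le_trans h _.
rewrite le_eqVlt; apply/orP; left; apply/eqP; ring.
Qed.

Lemma enormD u v : enorm (u + v) <= enorm u + enorm v.
Proof.
rewrite -ler_sqr ?nnegrE ?addr_ge0 ?enorm_ge0 // sqrrD !enorm_sqr.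
rewrite !(dotDl, dotDr) (dotC v u).
by have := cauchy_schwarz u v; rewrite mulr2n; lra.
Qed.

Lemma enormZ a u : enorm (a *: u) = `|a| * enorm u.
Proof. by rewrite /enorm dotZl dotZr mulrA -expr2 sqrtrM ?sqr_ge0// sqrtr_sqr. Qed.

Lemma enormN u : enorm (- u) = enorm u.
Proof. by rewrite -scaleN1r enormZ normrN1 mul1r. Qed.

Lemma enormB u v : enorm (u - v) <= enorm u + enorm v.
Proof. by rewrite -(enormN v) enormD. Qed.

Lemma enorm0 : enorm 0 = 0.
Proof. by rewrite -(scale0r 0) enormZ normr0 mul0r. Qed.

Lemma enorm_coord u i : `|u 0 i| <= enorm u.
Proof.
rewrite -ler_sqr ?nnegrE ?enorm_ge0 // real_normK ?num_real // enorm_sqr.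
rewrite /dot (bigD1 i) //= expr2 lerDl sumr_ge0 // => j _.
by rewrite -expr2 sqr_ge0.
Qed.

Lemma enorm_le_coord u c : 0 <= c -> (forall i, `|u 0 i| <= c) ->
  enorm u <= n%:R * c.
Proof.
move=> c0 h; rewrite -ler_sqr ?nnegrE ?mulr_ge0 ?enorm_ge0 // enorm_sqr.
apply: (@le_trans _ _ (n%:R * c ^+ 2)).
  rewrite /dot mulr_natl -[X in _ *+ X](card_ord n) -sumr_const.
  apply: ler_sum => i _; rewrite -expr2 -real_normK ?num_real //.
  by rewrite ler_sqr ?nnegrE.
rewrite exprMn ler_wpM2r ?sqr_ge0 // -natrX ler_nat; nia.
Qed.

Definition isometry_mx (f : 'rV[R]_n -> 'rV[R]_n) : 'M[R]_n :=
  \matrix_(i, j) (f (delta_mx 0 i) - f 0) 0 j.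

Lemma dot_delta u i : dot u (delta_mx 0 i) = u 0 i.
Proof.
rewrite /dot (bigD1 i) //= mxE !eqxx mulr1 big1 ?addr0 // => j ji.
by rewrite mxE (negbTE ji) andbF mulr0.
Qed.

Lemma isometry_dot f : Defs.isometry f ->
  forall x y, dot (f x - f 0) (f y - f 0) = dot x y.
Proof.
move=> iso x y.
have sq a b : dot (f a - f b) (f a - f b) = dot (a - b) (a - b).
  by rewrite -!enorm_sqr -!edist_enorm iso.
have := sq x y; have := sq x 0; have := sq y 0; rewrite !subr0.
have -> : f x - f y = (f x - f 0) + (-1) *: (f y - f 0).
  by rewrite scaleN1r opprB addrA subrK.
have -> : x - y = x + (-1) *: y by rewrite scaleN1r.
move: (f x - f 0) (f y - f 0) => a b.
rewrite !(dotDl, dotDr, dotZl, dotZr) (dotC b a) (dotC y x); lra.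
Qed.

(** The matrix [Q] of images of the basis vectors is orthogonal, and
    [(f x - f 0) *m Q^T] recovers [x], its entries being inner products that [f]
    preserves; multiplying by [Q] gives linearity. *)
Lemma isometry_affine f : Defs.isometry f ->
  forall x y, f x - f y = (x - y) *m isometry_mx f.
Proof.
move=> iso; have fdot := isometry_dot iso.
set Q := isometry_mx f.
have rowQ x : (f x - f 0) *m Q^T = x.
  apply/rowP => i; rewrite mxE -[RHS]dot_delta -fdot.
  by apply: eq_bigr => j _; rewrite !mxE.
have QQ : Q *m Q^T = 1%:M.
  apply/row_matrixP => i; rewrite row_mul rowE row1 -[RHS]rowQ; congr (_ *m _).
  by apply/rowP => j; rewrite -rowE !mxE.
have lin x : f x - f 0 = x *m Q.
  by rewrite -{2}(rowQ x) -mulmxA (mulmx1C QQ) mulmx1.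
by move=> x y; rewrite mulmxBl -!lin opprB addrA subrK.
Qed.

Lemma isometry_mx_le1 f : Defs.isometry f -> forall i j, `|isometry_mx f i j| <= 1.
Proof.
move=> iso i j; rewrite mxE; apply: le_trans (enorm_coord _ _) _.
rewrite -edist_enorm iso edist_enorm subr0 -(@ler_sqr R) ?nnegrE ?enorm_ge0 //.
by rewrite enorm_sqr dot_delta mxE !eqxx expr1n.
Qed.

End Euclid.

(** * Integer points modulo the period *)

Section Torus.
Variables (R : realType) (n M : nat).
Local Notation G := 'rV['Z_M]_n.
Implicit Types (z w : 'rV[int]_n) (x y : 'rV[R]_n).

Definition residue z : G := map_mx intr z.
Definition real_row z : 'rV[R]_n := map_mx intr z.
Definition floor_row x : 'rV[int]_n := map_mx Num.floor x.

Lemma residue_eq z w : (1 < M)%N -> residue z = residue w -> exists u, z = w + M%:Z *: u.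
Proof.
move=> M_gt1 zw; have /= h i : exists q, z 0 i - w 0 i = q * M%:Z.
  apply/dvdzP; rewrite /dvdz /= .
  have : (z 0 i - w 0 i)%:~R = 0 :> 'Z_M.
    rewrite rmorphB /=; apply/eqP; rewrite subr_eq0; apply/eqP.
    by move/rowP: zw => /(_ i); rewrite !mxE.
  move: (z 0 i - w 0 i) => a a0.
  have : (`|a|%N)%:R = 0 :> 'Z_M.
    case: a a0 => k //=; rewrite NegzE rmorphN /= => /eqP.
    by rewrite oppr_eq0 => /eqP.
  by move=> /(congr1 val) /=; rewrite val_Zp_nat // => /eqP.
have [u uE] := choice h; exists (\row_i u i); apply/rowP => i.
by rewrite !mxE mulrC -uE addrC subrK.
Qed.

(** Balls of diameter less than the period embed in the torus. *)
Lemma residue_eq_near z w : (1 < M)%N -> residue z = residue w ->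
  enorm (real_row (z - w)) < M%:R -> z = w.
Proof.
move=> M_gt1 /(residue_eq M_gt1)[u ->]; rewrite addrAC subrr add0r => small.
suff -> : u = 0 by rewrite scaler0 addr0.
apply/rowP => i; rewrite mxE; apply/eqP; rewrite -absz_eq0.
have := le_lt_trans (enorm_coord _ i) small.
rewrite !mxE rmorphM normrM /= -pmulrn normr_nat -[ltRHS]mulr1 ltr_pM2l; last first.
  by rewrite ltr0n; lia.
by rewrite -intr_norm -[1](mulr1z 1) ltr_int; lia.
Qed.

Lemma real_rowD z w : real_row (z + w) = real_row z + real_row w.
Proof. exact: map_mxD. Qed.

Lemma real_rowB z w : real_row (z - w) = real_row z - real_row w.
Proof. exact: map_mxB. Qed.

Lemma enorm_floor_row x : enorm (real_row (floor_row x) - x) <= n%:R.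
Proof.
rewrite -[leRHS]mulr1; apply: enorm_le_coord => // i; rewrite !mxE.
have := floor_le (x 0 i); have := floorD1_gt (x 0 i); rewrite rmorphD /=.
by rewrite ler_norml; lra.
Qed.

Definition ball_residues (r : R) : {set G} :=
  [set g | `[< exists2 z, residue z = g & enorm (real_row z) < r >]]%SET.

Lemma ball_residuesP r g :
  reflect (exists2 z, residue z = g & enorm (real_row z) < r)
          (g \in ball_residues r).
Proof. by rewrite inE; apply: asboolP. Qed.

Lemma ball_residuesN r g : g \in ball_residues r -> - g \in ball_residues r.
Proof.
move=> /ball_residuesP[z zg zr]; apply/ball_residuesP; exists (- z).
  by rewrite /residue map_mxN -zg.
by rewrite /real_row map_mxN enormN.
Qed.

Lemma ball_residues0 r : 0 < r -> 0 \in ball_residues r.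
Proof.
move=> r0; apply/ball_residuesP; exists 0; first exact: map_mx0.
by rewrite /real_row map_mx0 enorm0.
Qed.

(** Write an integer vector of norm less than [r] as [k * q + s] with digits
    [s] in [0, k): then [q] has norm less than [r / k + n], and there are [k ^ n]
    choices of [s]. *)
Lemma card_ball_residues (k : nat) r : (0 < k)%N ->
  (#|ball_residues r| <= k ^ n * #|ball_residues (r / k%:R + n%:R)|)%N.
Proof.
move=> k0; set B := ball_residues (_ + _).
have kR : 0 < k%:R :> R by rewrite ltr0n.
pose digits (s : {ffun 'I_n -> 'I_k}) : 'rV[int]_n := \row_i (s i)%:Z.
pose F (p : {ffun 'I_n -> 'I_k} * G) : G := residue (digits p.1) + p.2 *+ k.
suff sub : ball_residues r \subset (F @: finset.setX finset.setT B)%SET.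
  apply: leq_trans (subset_leq_card sub) _; apply: leq_trans (leq_imset_card _ _) _.
  by rewrite cardsX cardsT card_ffun !card_ord.
apply/fintype.subsetP => _ /ball_residuesP[z <- zr].
have mod_lt (i : 'I_n) : (`|(z ord0 i %% k)%Z| < k)%N.
  have kZ : (0 < k%:Z)%R by rewrite ltz_nat.
  have := ltz_pmod (z ord0 i) kZ; have := modz_ge0 (z ord0 i) (lt0r_neq0 kZ); lia.
pose s : {ffun 'I_n -> 'I_k} := [ffun i => Ordinal (mod_lt i)].
pose q : 'rV[int]_n := \row_i (z ord0 i %/ k)%Z.
have sE i : (s i)%:Z = (z ord0 i %% k)%Z.
  rewrite ffunE /= gez0_abs // modz_ge0 //; lia.
have zE : z = digits s + q *+ k.
  apply/rowP => i; rewrite !mxE sE.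
  by rewrite mulmxnE mxE {1}(divz_eq (z ord0 i) k) addrC -mulr_natr natz.
apply/finset.imsetP; exists (s, residue q) => /=; last first.
  by rewrite /F /= {1}zE /residue map_mxD /= raddfMn.
rewrite finset.in_setX finset.in_setT /=; apply/ball_residuesP; exists q => //.
have -> : real_row q = k%:R^-1 *: (real_row z - real_row (digits s)).
  rewrite -real_rowB zE addrC addKr /real_row raddfMn /= -[X in _ *: X]scaler_nat scalerA.
  by rewrite mulVf ?scale1r // gt_eqF.
rewrite enormZ ger0_norm ?invr_ge0 ?ler0n //.
apply: (@lt_le_trans _ _ (k%:R^-1 * (r + n%:R * k%:R))).
  rewrite ltr_pM2l ?invr_gt0 //; apply: le_lt_trans (enormB _ _) _.
  rewrite ltr_leD //; apply: enorm_le_coord => [|i]; first exact: ltW.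
  by rewrite !mxE -pmulrn normr_nat ler_nat ltnW.
by rewrite mulrDr mulrC lerD2l mulrA mulrAC mulVf ?mul1r // gt_eqF.
Qed.

End Torus.

(** * Numerical estimates *)

Lemma half_le_ln (R : realType) (r : R) : 2 < r -> 1 / 2 <= ln r.
Proof.
move=> r2; have r0 : 0 < r by lra.
have : ln r^-1 <= r^-1 - 1.
  have -> : r^-1 = 1 + (r^-1 - 1) by rewrite addrC subrK.
  rewrite [1 + _ - 1]addrC addKr le_ln1Dx //.
  by rewrite ltrBrDl subrr invr_gt0.
rewrite lnV ?posrE // => h.
suff : r^-1 <= 1 / 2 by lra.
by rewrite mul1r lef_pV2 ?posrE //; lra.
Qed.

(** The left side is the number of indices of the net of isometries used
    below: [(Z/M)^n] with [M = 36 n q], and [n * n] matrix entries with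
    [24 n^2 q + 1] values each. *)
Lemma net_card_bound (R : realType) (n q : nat) (r : R) :
  (0 < n)%N -> (0 < q)%N -> 2 < r -> q%:R <= r + 1 ->
  ((36 * n * q) ^ n * (24 * n ^ 2 * q).+1 ^ (n * n))%:R
    <= expR (290 * n%:R ^+ 4 * ln r).
Proof.
move=> n0 q0 r2 qr; have ln2 := half_le_ln r2.
apply: (@le_trans _ _ ((36 * n ^ 2 * q) ^ (2 * n ^ 2))%:R).
  have b0 : (0 < 36 * n ^ 2 * q)%N by nia.
  rewrite ler_nat; apply: (@leq_trans ((36 * n ^ 2 * q) ^ (n + n * n))).
    by rewrite expnD leq_mul // leq_exp2r; nia.
  by rewrite leq_pexp2l //; nia.
have n1 : 1 <= n%:R :> R by rewrite ler1n.
set x : R := 145 * n%:R ^+ 2 * ln r.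
have base : (36 * n ^ 2 * q)%:R <= expR x.
  apply: (@le_trans _ _ (expR (72 * n%:R ^+ 2) * expR (ln r))).
    have r0 : 0 < r by lra.
    rewrite lnK ?posrE // !natrM -expr2.
    apply: (@le_trans _ _ ((72 * n%:R ^+ 2) * r)).
      have : 0 <= n%:R ^+ 2 :> R by rewrite sqr_ge0.
      by nra.
    by rewrite ler_pM2r //; have := expR_ge1Dx (72 * n%:R ^+ 2 : R); lra.
  rewrite -expRD ler_expR /x; have : 1 <= n%:R ^+ 2 :> R by rewrite exprn_ege1.
  by nra.
rewrite natrX; apply: (le_trans (lerXn2r _ _ _ base)); rewrite ?nnegrE ?expR_ge0 //.
rewrite -expRM_natl ler_expR !natrM -expr2 /x le_eqVlt; apply/orP; left; apply/eqP.
ring.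
Qed.

(** With [lam = 1 / (2 d)], the factor [(1 + lam) ^+ d] is at most
    [expR (1 / 2)], hence at most 2. *)
Lemma hardcore_occupation (R : realType) (d : nat) : (0 < d)%N ->
  let lam : R := (2 * d%:R)^-1 in
  [/\ lam / (1 + lam) ^+ d <= 1 & (4 * d%:R)^-1 <= lam / (1 + lam) ^+ d].
Proof.
move=> d0 lam; have dR : 1 <= d%:R :> R by rewrite ler1n.
have lam0 : 0 < lam by rewrite invr_gt0; lra.
have lam1 : lam <= 1 by rewrite invf_le1; lra.
have e1 : 1 <= (1 + lam) ^+ d by rewrite exprn_ege1 // lerDl ltW.
have e0 := lt_le_trans ltr01 e1.
split; first by rewrite ler_pdivrMr // mul1r (le_trans lam1).
rewrite ler_pdivlMr //.
have e2 : (1 + lam) ^+ d <= 2.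
  apply: (@le_trans _ _ (expR (1 / 2))).
    have -> : 1 / 2 = d%:R * lam by rewrite /lam; field; lra.
    rewrite expRM_natl lerXn2r ?nnegrE ?expR_ge0 ?expR_ge1Dx //; lra.
  rewrite -[1 / 2]opprK expRN -[leRHS]invrK lef_pV2 ?posrE ?expR_gt0 //.
  by have := expR_ge1Dx (- (1 / 2) : R); lra.
have lamE : lam = (4 * d%:R)^-1 * 2 by rewrite /lam; field; lra.
by rewrite [leRHS]lamE ler_pM2l // invr_gt0; lra.
Qed.

(** Here [c] is the number of events, and each has a probability of at most
    [(1 - p) ^+ (N * b)], which is at most [expR (- N / (4 * 6 ^ n))]. *)
Lemma union_bound_small (R : realType) (n N b d : nat) (c p t : R) :
  (0 < b)%N -> d = (6 ^ n * b)%N -> (4 * d%:R)^-1 <= p -> p <= 1 ->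
  c <= expR t -> 4 * 6 ^+ n * t < N%:R ->
  c * (1 - p) ^+ (N * b) < 1.
Proof.
move=> b0 -> pl p1 ct tN; have bR : 0 < b%:R :> R by rewrite ltr0n.
have e6 : 0 < 6 ^+ n :> R by rewrite exprn_gt0.
have h : (1 - p) ^+ (N * b) <= expR (- (N%:R / (4 * 6 ^+ n))).
  apply: (@le_trans _ _ (expR (- p) ^+ (N * b))).
    by rewrite lerXn2r ?nnegrE ?expR_ge0 ?subr_ge0 ?expR_ge1Dx.
  rewrite -expRM_natl ler_expR mulrN lerN2 natrM.
  have -> : N%:R / (4 * 6 ^+ n) = N%:R * b%:R * (4 * (6 ^ n * b)%:R)^-1 :> R.
    by rewrite natrM natrX; field; rewrite !gt_eqF.
  by rewrite ler_wpM2l ?mulr_ge0.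
have q0 : 0 <= (1 - p) ^+ (N * b) by rewrite exprn_ge0 ?subr_ge0.
apply: (le_lt_trans (ler_wpM2r q0 ct)).
apply: (le_lt_trans (ler_wpM2l (expR_ge0 t) h)).
by rewrite -expRD expR_lt1 subr_lt0 ltr_pdivlMr ?mulr_gt0 // mulrC.
Qed.

(** * The coloring *)

Lemma sub_telescope (V : zmodType) (a b c d : V) :
  a - (c + d) = (b - c) + (a - b - d).
Proof. by rewrite [RHS]addrC addrACA subrK opprD [- c - d]addrC. Qed.

Section Coloring.
Variables (R : realType) (n q N : nat) (kk : 'I_N.+1 -> 'rV[R]_n).
Hypotheses (n_gt0 : (0 < n)%N) (q_ge3 : (2 < q)%N).
Hypothesis kk_separated : forall i j, i != j -> 1 <= enorm (kk i - kk j).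
Hypothesis kk_diameter : forall i j, enorm (kk i - kk j) <= q%:R - 1.
(* There are 36 n grid steps per unit length; q, the period in units of length,
   is at least R_K. *)
Local Notation m := (36 * n)%N.
Local Notation M := (36 * n * q)%N.
Local Notation G := 'rV['Z_M]_n.
Local Notation B := (@ball_residues R n M).

Let M_gt1 : (1 < M)%N. Proof. nia. Qed.
Let nR : 1 <= n%:R :> R. Proof. by rewrite ler1n. Qed.
Let mE : m%:R = 36 * n%:R :> R. Proof. by rewrite natrM. Qed.
Let ME : M%:R = 36 * n%:R * q%:R :> R. Proof. by rewrite !natrM. Qed.
Let qR : 3 <= q%:R :> R. Proof. by rewrite (ler_nat R 3). Qed.

(** In grid steps, [72 * n] is the distance 2. *)
Definition conflict (v : G) : {set G} := [set u | u - v \in B (72 * n%:R)]%SET.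

Lemma conflictE u v : (u \in conflict v) = (u - v \in B (72 * n%:R)).
Proof. by rewrite [LHS]finset.in_set. Qed.

Lemma conflict_refl v : v \in conflict v.
Proof. by rewrite conflictE subrr ball_residues0 // pmulr_rgt0 // ltr0n. Qed.

Lemma conflict_sym u v : (u \in conflict v) = (v \in conflict u).
Proof.
by rewrite !conflictE; apply/idP/idP => h; rewrite -opprB; exact: ball_residuesN.
Qed.

(** Division by 6 sends the radius [72 n] to [12 n + n]. *)
Lemma card_conflict v : (#|conflict v| <= 6 ^ n * #|B (13 * n%:R)|)%N.
Proof.
have sub : conflict v \subset ([set g + v | g in B (72 * n%:R)])%SET.
  apply/fintype.subsetP => u; rewrite conflictE => uv.
  by apply/finset.imsetP; exists (u - v) => //; rewrite subrK.
apply: leq_trans (subset_leq_card sub) _; apply: leq_trans (leq_imset_card _ _) _.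
have := @card_ball_residues R n M 6 (72 * n%:R) isT.
suff -> : 72 * n%:R / 6 + n%:R = 13 * n%:R :> R by [].
by field.
Qed.

(** In grid steps, [18 * n] is the radius 1/2. *)
Definition ball_coloring (X : {set G}) (x : 'rV[R]_n) : color :=
  if `[< exists2 z, residue M z \in X &
         enorm (m%:R *: x - real_row R z) < 18 * n%:R >] then red else blue.

Lemma ball_coloringP X x : ball_coloring X x = red <->
  exists2 z, residue M z \in X & enorm (m%:R *: x - real_row R z) < 18 * n%:R.
Proof. by rewrite /ball_coloring; case: asboolP. Qed.

(** The centers of balls around two red points at distance 1 are less than 2
    apart, so their residues coincide by independence, and the centers
    themselves coincide as the period is at least 3; but two points of one ball
    are less than 1 apart. *)
Lemma ball_coloring_unit X x y : independent conflict X ->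
  enorm (x - y) = 1 -> ball_coloring X x = red -> ball_coloring X y <> red.
Proof.
move=> /independentP Xi xy /ball_coloringP[z zX zx] /ball_coloringP[w wX wy].
have mxy : enorm (m%:R *: (x - y)) = 36 * n%:R.
  by rewrite enormZ xy normr_nat mulr1 mE.
have zw : enorm (real_row R (z - w)) < 72 * n%:R.
  have -> : real_row R (z - w) = (m%:R *: y - real_row R w)
      - (m%:R *: x - real_row R z) + m%:R *: (x - y).
    rewrite real_rowB scalerBr; set a := _ *: x; set b := _ *: y.
    by apply/rowP => i; rewrite !mxE; lra.
  apply: le_lt_trans (enormD _ _) _; have := enormB (m%:R *: y - real_row R w)
    (m%:R *: x - real_row R z).
  by rewrite mxy; lra.
have res : residue M z = residue M w.
  apply: Xi => //; rewrite conflictE; apply/ball_residuesP; exists (z - w) => //.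
  by rewrite /residue map_mxB.
have {res} zwE : z = w.
  apply: (residue_eq_near M_gt1 res (R := R)); apply: lt_trans zw _; rewrite ME.
  have := nR; have := qR; nra.
subst w; suff : enorm (m%:R *: (x - y)) < 36 * n%:R by rewrite mxy ltxx.
have -> : m%:R *: (x - y) = (m%:R *: x - real_row R z)
    - (m%:R *: y - real_row R z).
  by rewrite scalerBr opprB addrA subrK.
by apply: le_lt_trans (enormB _ _) _; lra.
Qed.

(** The radius [13 * n] is measured from the rounded points, at distance at
    most [n] from the true ones.  The resulting [14 * n] leaves a margin of
    [4 * n] below [18 * n] for the error of the net of isometries. *)
Definition red_block (f : 'rV[R]_n -> 'rV[R]_n) : {set G} :=
  [set residue M (floor_row (m%:R *: f (kk p.1))) + p.2
    | p in finset.setX [set: 'I_N.+1]%SET (B (13 * n%:R))]%SET.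

Lemma red_blockP f g : g \in red_block f -> exists k z,
  residue M z = g /\ enorm (m%:R *: f (kk k) - real_row R z) < 14 * n%:R.
Proof.
move=> /finset.imsetP[[k a]]; rewrite finset.in_setX /= => /andP[_].
move=> /ball_residuesP[z <- zr] ->; exists k, (floor_row (m%:R *: f (kk k)) + z).
split; first by rewrite /residue map_mxD.
have := enorm_floor_row (m%:R *: f (kk k)); set c := floor_row _ => cf.
have -> : m%:R *: f (kk k) - real_row R (c + z) =
    - (real_row R c - m%:R *: f (kk k)) - real_row R z.
  by rewrite real_rowD opprB opprD addrA.
by apply: le_lt_trans (enormB _ _) _; rewrite enormN; lra.
Qed.

(** Two elements of different balls differ by less than the period because of
    the bound on the diameter, so coinciding residues would give a common grid
    point, against separation. *)
Lemma card_red_block f : Defs.isometry f ->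
  #|red_block f| = (N.+1 * #|B (13 * n%:R)|)%N.
Proof.
move=> iso; rewrite card_in_imset ?cardsX ?cardsT ?card_ord //.
move=> [i a] [j b]; rewrite !finset.in_setX /= => /andP[_ aB] /andP[_ bB].
have fd : enorm (f (kk i) - f (kk j)) = enorm (kk i - kk j).
  by rewrite -!edist_enorm iso.
move/ball_residuesP: aB => [z <- zr]; move/ball_residuesP: bB => [w <- wr].
set c := floor_row (m%:R *: f (kk i)); set c' := floor_row (m%:R *: f (kk j)) => cz.
have res : residue M (c + z) = residue M (c' + w) by rewrite /residue !map_mxD.
have cn := enorm_floor_row (m%:R *: f (kk i)).
have cn' := enorm_floor_row (m%:R *: f (kk j)).
(* The offsets of the two grid points from the points of the copy. *)
pose e := (real_row R c - m%:R *: f (kk i)) + real_row R z.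
pose e' := (real_row R c' - m%:R *: f (kk j)) + real_row R w.
have ee : enorm (e - e') < 28 * n%:R.
  apply: le_lt_trans (enormB _ _) _.
  have := enormD (real_row R c - m%:R *: f (kk i)) (real_row R z).
  have := enormD (real_row R c' - m%:R *: f (kk j)) (real_row R w).
  by rewrite -/e -/e'; lra.
have key : real_row R (c + z - (c' + w)) = e - e' + m%:R *: (f (kk i) - f (kk j)).
  rewrite real_rowB !real_rowD scalerBr /e /e'.
  by apply/rowP => l; rewrite !mxE; lra.
have czE : c + z = c' + w.
  apply: (residue_eq_near M_gt1 res (R := R)); rewrite key ME.
  apply: le_lt_trans (enormD _ _) _; rewrite enormZ normr_nat mE fd.
  by have := kk_diameter i j; have := nR; nra.
have ij : i = j.
  apply/eqP/negPn/negP => /kk_separated; rewrite -fd => far.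
  move: key; rewrite czE subrr.
  move/(congr1 (fun x => enorm (e' - e + x))); rewrite {1}/real_row map_mx0 addr0.
  have -> : e' - e + (e - e' + m%:R *: (f (kk i) - f (kk j))) =
    m%:R *: (f (kk i) - f (kk j)) by rewrite -(opprB e e') addKr.
  rewrite enormZ normr_nat mE -(opprB e e') enormN => eq_e; have := nR; nra.
by subst j; rewrite (addrI _ czE).
Qed.

Local Notation h := (12 * n ^ 2 * q)%N.

(** The entries of an orthogonal matrix are in [-1, 1]; adding [h] to their
    multiples by [h] makes the rounded values natural numbers up to [2 h]. *)
Definition net_index (f : 'rV[R]_n -> 'rV[R]_n) : G * 'M['I_(24 * n ^ 2 * q).+1]_n :=
  (residue M (floor_row (m%:R *: f (kk ord0))),
   \matrix_(i, j) inord `|Num.floor (h%:R * isometry_mx f i j + h%:R)|%N).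

Lemma net_index_mx f g : Defs.isometry f -> Defs.isometry g ->
  net_index f = net_index g ->
  forall i j, `|isometry_mx f i j - isometry_mx g i j| <= h%:R^-1.
Proof.
move=> fi gi fg i j.
have hR : 0 < h%:R :> R by rewrite ltr0n; nia.
have := isometry_mx_le1 fi i j; have := isometry_mx_le1 gi i j.
move/(congr1 snd)/matrixP/(_ i j): fg => /= fg; rewrite [LHS]mxE [RHS]mxE in fg.
move: fg.
set x := isometry_mx f i j; set y := isometry_mx g i j.
have range (t : R) : `|t| <= 1 -> exists2 a : nat,
    (a < (24 * n ^ 2 * q).+1)%N & Num.floor (h%:R * t + h%:R) = a%:Z.
  rewrite ler_norml => /andP[t1 t2].
  have f0 : (0 <= Num.floor (h%:R * t + h%:R))%R by rewrite floor_ge0; nra.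
  exists `|Num.floor (h%:R * t + h%:R)|%N; last by rewrite gez0_abs.
  rewrite ltnS -lez_nat gez0_abs // -(ler_int R); apply: le_trans (floor_le _) _.
  have -> : (24 * n ^ 2 * q = h + h)%N by lia.
  by rewrite -pmulrn natrD lerD2r; nra.
move=> + /range[b bl yb] /range[a al xa]; rewrite xa yb /= => /(congr1 val).
rewrite /= !inordK // => ab; rewrite {}ab in xa al.
have := floor_le (h%:R * x + h%:R); have := floorD1_gt (h%:R * x + h%:R).
have := floor_le (h%:R * y + h%:R); have := floorD1_gt (h%:R * y + h%:R).
rewrite xa yb !intrD; set c := (b%:Z%:~R : R) => h1 h2 h3 h4.
rewrite -[leRHS]mulr1 mulrC ler_pdivlMr // -[X in _ * X]gtr0_norm // -normrM.
by rewrite ler_norml; nra.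
Qed.

(** The base point contributes an error of at most [n] grid steps and the matrix
    one of at most [36 n * (n * n * q / h) = 3 n]; the period [M *: u] is
    harmless, the coloring being periodic. *)
Lemma net_index_near f g : Defs.isometry f -> Defs.isometry g ->
  net_index f = net_index g ->
  exists u, forall k, enorm (m%:R *: (f (kk k) - g (kk k)) - real_row R (M%:Z *: u))
    <= 4 * n%:R.
Proof.
move=> fi gi fg; have mx := net_index_mx fi gi fg.
move/(congr1 fst): fg => /= /(residue_eq M_gt1)[u uE]; exists u => k.
set x0 := kk ord0; set D := isometry_mx f - isometry_mx g.
have hR : 0 < h%:R :> R by rewrite ltr0n; nia.
have lin : f (kk k) - g (kk k) = (f x0 - g x0) + (kk k - x0) *m D.
  rewrite mulmxBr -!isometry_affine //; apply/rowP => i; rewrite !mxE; lra.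
have base : enorm (m%:R *: (f x0 - g x0) - real_row R (M%:Z *: u)) <= n%:R.
  rewrite -[leRHS]mulr1; apply: enorm_le_coord => // i.
  have := congr1 (fun z : 'rV[int]_n => (z 0 i)%:~R : R) uE; rewrite /= !mxE intrD.
  set a := Num.floor _; set b := Num.floor _; set c := (_ * _)%:~R => abc.
  have := floor_le (m%:R * f x0 0 i); have := floorD1_gt (m%:R * f x0 0 i).
  have := floor_le (m%:R * g x0 0 i); have := floorD1_gt (m%:R * g x0 0 i).
  rewrite !intrD -/a -/b => h1 h2 h3 h4; rewrite ler_norml mulrDr mulrN; lra.
have rot : enorm ((kk k - x0) *m D) <= n%:R * (n%:R * ((q%:R - 1) * h%:R^-1)).
  apply: enorm_le_coord => [|j].
    by have := qR => q3; rewrite !mulr_ge0 ?invr_ge0 ?ler0n //; lra.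
  rewrite mxE; apply: le_trans (ler_norm_sum _ _ _) _.
  apply: (@le_trans _ _ (\sum_(i < n) ((q%:R - 1) * h%:R^-1))).
    apply: ler_sum => i _; rewrite normrM ler_pM //.
      exact: le_trans (enorm_coord _ _) (kk_diameter _ _).
    by have := mx i j; rewrite !mxE.
  by rewrite sumr_const card_ord mulr_natl.
rewrite lin scalerDr addrAC; apply: le_trans (enormD _ _) _.
rewrite enormZ normr_nat [X in _ + X * _]mE.
have hE : n%:R * (n%:R * ((q%:R - 1) * h%:R^-1)) <= 1 / 12 :> R.
  have n2 : 0 <= n%:R * n%:R :> R by rewrite mulr_ge0.
  rewrite !mulrA ler_pdivrMr // !natrM.
  have -> : 1 / 12 * (12 * (n%:R * n%:R) * q%:R) = n%:R * n%:R * q%:R :> R by field.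
  by rewrite ler_wpM2l // gerBl.
by have := nR; nra.
Qed.

Lemma card_net : #|{: G * 'M['I_(24 * n ^ 2 * q).+1]_n}| =
  ((36 * n * q) ^ n * (24 * n ^ 2 * q).+1 ^ (n * n))%N.
Proof. by rewrite card_prod !card_mx !card_ord mul1n Zp_cast. Qed.

(** A representative isometry is chosen for each index of the net that occurs;
    an independent set hitting the blocks of the representatives gives a red
    point in the image of [kk] by any isometry. *)
Lemma avoiding_coloring (r : R) : 2 < r -> q%:R <= r + 1 ->
  4 * 6 ^+ n * (290 * n%:R ^+ 4 * ln r) < N.+1%:R ->
  exists chi : 'rV[R]_n -> color,
    (forall x y, enorm (x - y) = 1 -> chi x = red -> chi y <> red) /\
    (forall f, Defs.isometry f -> exists k, chi (f (kk k)) = red).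
Proof.
move=> r2 qr big.
pose b := #|B (13 * n%:R)|; pose d := (6 ^ n * b)%N.
have b0 : (0 < b)%N.
  by apply/card_gt0P; exists 0; apply: ball_residues0; have := nR; lra.
have d0 : (0 < d)%N by rewrite muln_gt0 expn_gt0.
have [p1 pl] := hardcore_occupation R d0; set lam : R := (2 * d%:R)^-1 in p1 pl.
have lam0 : 0 <= lam by rewrite invr_ge0 mulr_ge0.
pose good i := `[< exists2 f, Defs.isometry f & net_index f = i >].
have rep i : exists f, good i -> Defs.isometry f /\ net_index f = i.
  have [[f fi fE]|no] := pselect (exists2 f, Defs.isometry f & net_index f = i).
    by exists f.
  by exists id => /asboolP.
have [F FP] := choice rep.
have [||X [Xi hit]] := independent_hitting (R := R) conflict_refl conflict_sym
    lam0 (P := good) (D := fun i => red_block (F i)) (s := N.+1 * b) card_conflict p1.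
- by move=> i /FP[iso _]; rewrite card_red_block.
- rewrite card_net; apply: (union_bound_small b0 (erefl d) pl p1 _ big).
  by apply: net_card_bound => //; lia.
exists (ball_coloring X); split=> [x y|f iso]; first exact: ball_coloring_unit.
have gf : good (net_index f) by apply/asboolP; exists f.
have [g gX gD] := hit _ gf; have [gi gE] := FP _ gf.
have [k [z [zg zk]]] := red_blockP gD.
have [u uP] := net_index_near iso gi (esym gE).
exists k; apply/ball_coloringP; exists (z + M%:Z *: u).
  suff -> : residue M (z + M%:Z *: u) = residue M z by rewrite zg.
  have M0 a : (M%:Z * a)%:~R = 0 :> 'Z_M.
    by rewrite intrM -pmulrn (pchar_Zp M_gt1) mul0r.
  rewrite /residue map_mxD; apply/rowP => i; rewrite !mxE.
  by rewrite -[RHS]addr0; congr (_ + _); exact: M0.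
have := uP k; rewrite real_rowD; set Mu := real_row R (_ *: u) => near.
have -> : m%:R *: f (kk k) - (real_row R z + Mu) =
    (m%:R *: F (net_index f) (kk k) - real_row R z)
    + (m%:R *: (f (kk k) - F (net_index f) (kk k)) - Mu).
  by rewrite scalerBr -sub_telescope.
have -> : 18 * n%:R = 14 * n%:R + 4 * n%:R :> R by ring.
exact: le_lt_trans (enormD _ _) (ltr_leD zk near).
Qed.

End Coloring.

(** * The theorem *)

Lemma bernoulli_le (R : realType) (a : R) k : 0 <= a -> 1 + k%:R * a <= (1 + a) ^+ k.
Proof.
move=> a0; elim: k => [|k ih]; first by rewrite mul0r addr0 expr0.
have k0 : 0 <= k%:R * a ^+ 2 by rewrite mulr_ge0 ?sqr_ge0.
rewrite exprS -natr1; apply: le_trans (ler_wpM2l (addr_ge0 ler01 a0) ih).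
by rewrite -subr_ge0 (_ : _ - _ = k%:R * a ^+ 2) //; ring.
Qed.

(** The ratio (6.79 / 6)^n dominates the fifth power of [n / 40], by the Bernoulli
    inequality for the exponent [n %/ 5]. *)
Lemma polynomial_loss (R : realType) : \forall n \near \oo,
  1160 * n%:R ^+ 4 * 6 ^+ n <= (679 / 100) ^+ n :> R.
Proof.
near=> n.
have nbig : 1160 * 40 ^+ 5 <= n%:R :> R by near: n; exact: nbhs_infty_ger.
have -> : 679 / 100 = (1 + 79 / 600) * 6 :> R by field.
rewrite exprMn ler_pM2r ?exprn_gt0 //.
set a : R := 79 / 600; have a0 : 0 <= a by rewrite /a; lra.
have low : n%:R / 40 <= (1 + a) ^+ (n %/ 5).
  apply: le_trans (bernoulli_le _ a0).
  have : n%:R <= 5 * (n %/ 5)%:R + 4 :> R.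
    by rewrite -natrM -natrD ler_nat; lia.
  by rewrite /a; lra.
apply: (@le_trans _ _ (((1 + a) ^+ (n %/ 5)) ^+ 5)); last first.
  by rewrite -exprM ler_weXn2l ?lerDl //; lia.
apply: (@le_trans _ _ ((n%:R / 40) ^+ 5)); last first.
  by rewrite lerXn2r ?nnegrE ?exprn_ge0 ?divr_ge0 ?addr_ge0.
rewrite expr_div_n ler_pdivlMr ?exprn_gt0 // (exprS _ 4) mulrAC.
by rewrite ler_wpM2r // exprn_ge0.
Unshelve. all: by end_near.
Qed.

Definition loss (R : realType) (n : nat) : R :=
  if 1160 * n%:R ^+ 4 * 6 ^+ n <= (679 / 100) ^+ n :> R then 0
  else 1160 * n%:R ^+ 4 * 6 ^+ n.

Lemma loss_cvg (R : realType) : loss R n @[n --> \oo] --> (0 : R).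
Proof.
apply: cvg_near_cst; apply: filterS (polynomial_loss R) => n h.
by rewrite /loss h.
Qed.

Lemma loss_ge (R : realType) (n : nat) : (0 < n)%N ->
  1160 * n%:R ^+ 4 * 6 ^+ n <= (679 / 100 + loss R n) ^+ n.
Proof.
move=> n0; rewrite /loss; case: ifP => [h|_]; first by rewrite addr0.
set c := 1160 * _ * _.
have c0 : 0 <= c by apply: mulr_ge0; [apply: mulr_ge0|]; rewrite ?exprn_ge0 ?ler0n.
apply: (@le_trans _ _ (679 / 100 + c)); first by lra.
by apply: ler_eXnr => //; lra.
Qed.

(** An infinite set is replaced by a large finite subset. *)
Lemma counting_gt (T : choiceType) (R : realType) (K : set T) (t : R) :
  (t%:E < counting K)%E ->
  exists s : seq T, [/\ uniq s, {in s, forall x, K x} & t < (size s)%:R].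
Proof.
rewrite /counting; case: asboolP => [fK|infK].
  rewrite lte_fin => h; exists (finmap.enum_fset (fset_set K)).
  split=> [|x|//]; first exact: finmap.fset_uniq.
  by move=> xK; rewrite -in_setE -in_fset_set.
have [s sK sz] := infinite_set_fset (Num.bound t) infK.
exists (finmap.enum_fset s); split=> [|x xs|]; first exact: finmap.fset_uniq.
  exact: sK.
have [t0|t0] := ltP t 0; first by apply: lt_le_trans t0 _.
by apply: lt_le_trans (archi_boundP t0) _; rewrite ler_nat.
Qed.

Theorem mainTheorem3 (R : realType) :
  exists eps : nat -> R,
    eps n @[n --> \oo] --> (0 : R) /\
    forall n : nat, (0 < n)%N ->
    forall RK : R, 2 < RK ->
    forall K : set 'rV[R]_n,
      one_separated K ->
      (diameter K <= (RK - 1)%:E)%E ->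
      (((679 / 100 + eps n) ^+ n * ln RK)%:E < counting K)%E ->
      forall L : set 'rV[R]_n, is_ell2 L -> not_arrow L K.
Proof.
exists (loss R); split=> [|n n0 RK RK2 K sep diam big L [p [q [pq ->]]]].
  exact: loss_cvg.
have [s [us sK sbig]] := counting_gt big.
have ln0 : 0 < ln RK by have := half_le_ln RK2; lra.
have sbig' : 4 * 6 ^+ n * (290 * n%:R ^+ 4 * ln RK) < (size s)%:R.
  apply: le_lt_trans sbig.
  have := ler_wpM2r (ltW ln0) (loss_ge R n0); lra.
have s0 : (0 < size s)%N.
  rewrite -(ltr_nat R); apply: le_lt_trans sbig'.
  apply: mulr_ge0; first by apply: mulr_ge0; rewrite ?exprn_ge0 ?ler0n.
  by apply: mulr_ge0 (ltW ln0); apply: mulr_ge0; rewrite ?exprn_ge0 ?ler0n.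
have [N sN] : exists N, size s = N.+1 by exists (size s).-1; rewrite prednK.
pose kk (i : 'I_N.+1) : 'rV[R]_n := nth 0 s i.
have kkK i : K (kk i) by apply/sK/mem_nth; rewrite sN.
pose m := (Num.trunc RK).+1.
have RK0 : 0 <= RK by lra.
have mRK : RK < m%:R by rewrite truncnS_gt.
have mle : m%:R <= RK + 1 by rewrite -natr1 lerD2r truncn_le.
have kk_sep i j : i != j -> 1 <= enorm (kk i - kk j).
  move=> ij; rewrite -edist_enorm; apply: sep => // /eqP.
  by rewrite nth_uniq ?sN // => /eqP/val_inj/eqP; apply/negP.
have kk_diam i j : enorm (kk i - kk j) <= m%:R - 1.
  apply: (@le_trans _ _ (RK - 1)); last by lra.
  rewrite -edist_enorm -lee_fin; apply: le_trans diam.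
  apply: ereal_sup_ubound; exists (kk i) => //; exists (kk j) => //.
have m3 : (2 < m)%N by rewrite -(ltr_nat R); lra.
rewrite sN in sbig'.
have [chi [unit hit]] := avoiding_coloring n0 m3 kk_sep kk_diam RK2 mle sbig'.
exists chi; split=> -[_ [f fi ->] mono].
  apply: (unit (f p) (f q)).
  - by rewrite -edist_enorm fi.
  - by apply: mono; exists p => //; left.
  - by apply: mono; exists q => //; right.
have [k] := hit f fi; rewrite mono //; by exists (kk k).
Qed.
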